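(* Let $\mathbf k$ be a field of characteristic $0$ and $n\ge1$. The map $\varphi:(r,s)\mapsto(\mathscr F(r),\mathscr F(s))$ is a bijection between the set of associative Yang-Baxter pairs on the matrix algebra $M_n(\mathbf k)$ and the set of coupled Rota-Baxter operators on $M_n(\mathbf k)$.
   Context: For an associative algebra $A$ and $r=\sum r^{[1]}\otimes r^{[2]}\in A\otimes A$, $\mathscr F(r):A\to A$ is the linear map $\mathscr F(r)(a)=\sum r^{[1]}a\,r^{[2]}$. A coupled Rota-Baxter operator on $A$ is a pair $(R,S)$ of $\mathbf k$-linear maps $R,S:A\to A$ such that for all $a,b\in A$, $$R(a)R(b)=R\big(R(a)b+aS(b)\big),\qquad S(a)S(b)=S\big(R(a)b+aS(b)\big)$$ (equivalently, $(A,R,S)$ is a Rota-Baxter system). An associative Yang-Baxter pair on a unitary associative algebra $A$ is a pair of elements $r,s\in A\otimes A$ satisfying in $A\otimes A\otimes A$ $$r^{13}r^{12}-r^{12}r^{23}+s^{23}r^{13}=0,\qquad s^{13}r^{12}-s^{12}s^{23}+s^{23}s^{13}=0,$$ where $r^{12}=r\otimes1$, $r^{13}=\sum r^{[1]}\otimes1\otimes r^{[2]}$, $r^{23}=1\otimes r$, and similarly for $s$. *)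

(* Defs.v *)
From HB Require Import structures.
From mathcomp Require Import all_boot all_order all_algebra.
From mathcomp Require Import boolp classical_sets functions.

Set Implicit Arguments.
Unset Strict Implicit.
Unset Printing Implicit Defensive.

Import GRing.Theory.
Local Open Scope ring_scope.
Local Open Scope quotient_scope.
Local Open Scope classical_set_scope.

Local Notation bilinear_map f := (bilinear_for *:%R *:%R f).

Section TensorProduct.
Variable k : fieldType.

Section Eval.
Variables (U V W : lmodType k).

Definition tsum (f : U -> V -> W) (s : seq (U * V)) : W :=
  \sum_(p <- s) f p.1 p.2.

End Eval.

Section Quotient.
Variables (U V : lmodType k).
Implicit Types s t : seq (U * V).

(* A list [:: (u1, v1); ...; (um, vm)] stands for the formal sum of the pairs
   (ui, vi).  Two formal sums represent the same tensor iff every bilinear map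
   takes the same value on them: by the universal property this is the
   relation that defines the tensor product over k. *)
Definition tensor_equiv : rel (seq (U * V)) := fun s t =>
  `[< forall (W : lmodType k) (f : U -> V -> W), bilinear_map f ->
        tsum f s = tsum f t >].

Lemma tensor_equiv_refl : reflexive tensor_equiv.
Proof. by move=> s; apply/asboolP. Qed.

Lemma tensor_equiv_sym : symmetric tensor_equiv.
Proof.
by move=> s t; apply/asboolP/asboolP => st W f bf; rewrite (st W f bf).
Qed.

Lemma tensor_equiv_trans : transitive tensor_equiv.
Proof.
move=> t s u /asboolP st /asboolP tu; apply/asboolP => W f bf.
by rewrite (st W f bf) (tu W f bf).
Qed.

Canonical tensor_equiv_rel :=
  EquivRel tensor_equiv tensor_equiv_refl tensor_equiv_sym tensor_equiv_trans.

Definition tensor : Type := {eq_quot tensor_equiv}.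

HB.instance Definition _ := Choice.on tensor.
HB.instance Definition _ := EqQuotient.on tensor.

(* The linear map induced by f; meaningful only when f is bilinear. *)
Definition tlift (W : lmodType k) (f : U -> V -> W) (x : tensor) : W :=
  tsum f (repr x).

Lemma tlift_pi (W : lmodType k) (f : U -> V -> W) s :
  bilinear_map f -> tlift f (\pi_tensor s) = tsum f s.
Proof.
move=> bf; rewrite /tlift.
have /eqmodP/asboolP -> // : repr (\pi_tensor s) = s %[mod tensor].
by rewrite reprK.
Qed.

Lemma eq_tensor (x y : tensor) :
  (forall (W : lmodType k) (f : U -> V -> W), bilinear_map f ->
     tlift f x = tlift f y) -> x = y.
Proof.
by move=> xy; rewrite -[x]reprK -[y]reprK; apply/eqmodP/asboolP.
Qed.

Definition tens (u : U) (v : V) : tensor := \pi_tensor [:: (u, v)].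
Definition tzero : tensor := \pi_tensor [::].
Definition tadd (x y : tensor) : tensor := \pi_tensor (repr x ++ repr y).
Definition tscale (c : k) (x : tensor) : tensor :=
  \pi_tensor [seq (c *: p.1, p.2) | p <- repr x].
Definition topp (x : tensor) : tensor := tscale (- 1) x.

Lemma tlift_tens (W : lmodType k) (f : U -> V -> W) u v :
  bilinear_map f -> tlift f (tens u v) = f u v.
Proof. by move=> bf; rewrite tlift_pi // /tsum big_seq1. Qed.

Lemma tlift_zero (W : lmodType k) (f : U -> V -> W) :
  bilinear_map f -> tlift f tzero = 0.
Proof. by move=> bf; rewrite tlift_pi // /tsum big_nil. Qed.

Lemma tlift_add (W : lmodType k) (f : U -> V -> W) x y :
  bilinear_map f -> tlift f (tadd x y) = tlift f x + tlift f y.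
Proof. by move=> bf; rewrite tlift_pi // /tsum big_cat. Qed.

Lemma bilin_Zl (W : lmodType k) (f : U -> V -> W) c u v :
  bilinear_map f -> f (c *: u) v = c *: f u v.
Proof. by move=> -[bl _]; exact: (scalable_linear (bl v)). Qed.

Lemma bilin_Zr (W : lmodType k) (f : U -> V -> W) c u v :
  bilinear_map f -> f u (c *: v) = c *: f u v.
Proof. by move=> -[_ br]; exact: (scalable_linear (br u)). Qed.

Lemma bilin_Dl (W : lmodType k) (f : U -> V -> W) u u' v :
  bilinear_map f -> f (u + u') v = f u v + f u' v.
Proof. by move=> -[bl _]; have := bl v 1 u u'; rewrite /= !scale1r. Qed.

Lemma bilin_Dr (W : lmodType k) (f : U -> V -> W) u v v' :
  bilinear_map f -> f u (v + v') = f u v + f u v'.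
Proof. by move=> -[_ br]; have := br u 1 v v'; rewrite /= !scale1r. Qed.

Lemma tlift_scale (W : lmodType k) (f : U -> V -> W) c x :
  bilinear_map f -> tlift f (tscale c x) = c *: tlift f x.
Proof.
move=> bf; rewrite tlift_pi // /tlift /tsum big_map scaler_sumr.
by apply: eq_bigr => p _; exact: bilin_Zl.
Qed.

Let tE := (tlift_add, tlift_zero, tlift_scale).

Lemma taddA : associative tadd.
Proof. by move=> x y z; apply: eq_tensor => W f bf; rewrite !tE // addrA. Qed.
Lemma taddC : commutative tadd.
Proof. by move=> x y; apply: eq_tensor => W f bf; rewrite !tE // addrC. Qed.
Lemma tadd0 : left_id tzero tadd.
Proof. by move=> x; apply: eq_tensor => W f bf; rewrite !tE // add0r. Qed.
Lemma taddN : left_inverse tzero topp tadd.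
Proof.
by move=> x; apply: eq_tensor => W f bf; rewrite !tE // scaleN1r addNr.
Qed.

HB.instance Definition _ :=
  GRing.isZmodule.Build tensor taddA taddC tadd0 taddN.

Lemma tscaleA a b x : tscale a (tscale b x) = tscale (a * b) x.
Proof. by apply: eq_tensor => W f bf; rewrite !tE // scalerA. Qed.
Lemma tscale1 : left_id 1 tscale.
Proof. by move=> x; apply: eq_tensor => W f bf; rewrite !tE // scale1r. Qed.
Lemma tscaleDr : right_distributive tscale +%R.
Proof.
by move=> c x y; apply: eq_tensor => W f bf; rewrite !tE // scalerDr.
Qed.
Lemma tscaleDl x : {morph tscale^~ x : a b / a + b}.
Proof. by move=> a b; apply: eq_tensor => W f bf; rewrite !tE // scalerDl. Qed.

HB.instance Definition _ :=
  GRing.Zmodule_isLmodule.Build k tensor tscaleA tscale1 tscaleDr tscaleDl.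

Lemma tens_bilinear : bilinear_map tens.
Proof.
split=> z c x y; apply: eq_tensor => W f bf; rewrite !tE // !tlift_tens //.
  exact: bf.1.
exact: bf.2.
Qed.

Lemma tlift_linear (W : lmodType k) (f : U -> V -> W) :
  bilinear_map f -> linear (tlift f).
Proof. by move=> bf c x y; rewrite !tE. Qed.

Lemma tensorE (x : tensor) : x = \sum_(p <- repr x) tens p.1 p.2.
Proof.
suff H s : \pi_tensor s = \sum_(p <- s) tens p.1 p.2 by rewrite -H reprK.
elim: s => [|[u v] s IHs]; first by rewrite big_nil.
rewrite big_cons -IHs; apply: eq_tensor => W f bf.
by rewrite !tE // tlift_tens // !tlift_pi // /tsum big_cons.
Qed.

Lemma tensor_ext (W : lmodType k) (f g : tensor -> W) :
  linear f -> linear g -> (forall u v, f (tens u v) = g (tens u v)) -> f =1 g.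
Proof.
move=> lf lg fg x; rewrite (tensorE x).
elim: (repr x) => [|p s IHs].
  have lin0 (h : tensor -> W) : linear h -> h 0 = 0.
    by move=> lh; have := scalable_linear lh 0 0; rewrite /= !scale0r.
  by rewrite big_nil !lin0.
by rewrite big_cons -[tens _ _]scale1r lf lg IHs fg.
Qed.

End Quotient.

End TensorProduct.

Notation "u *t v" := (tens u v) (at level 40, left associativity) : ring_scope.

Section TensorAlgebra.
Variables (k : fieldType).

Lemma exists_functional (A : lmodType k) (e : A) : e != 0 ->
  exists2 f : A -> k^o, linear f & f e = 1.
Proof.
move=> e0.
pose P (W : set A) := ~ W e /\ forall c x y, W x -> W y -> W (c *: x + y).
have [|W [[We Wlin] Wmax]] := @Zorn_bigcup A P.
  move=> F FP Ftot; split=> [[X FX Xe]|c x y [X FX Xx] [Y FY Yy]].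
    by case: (FP _ FX).
  have [XY|YX] := Ftot _ _ FX FY.
    by exists Y => //; apply: (FP _ FY).2 => //; exact: XY.
  by exists X => //; apply: (FP _ FX).2 => //; exact: YX.
have W0 : W 0.
  have [//|nW0] := pselect (W 0).
  have Wno x : ~ W x.
    by move=> Wx; apply: nW0; rewrite -[0](addNr x) -scaleN1r; exact: Wlin.
  exfalso; apply: (Wmax [set 0]).
    by split=> [x /Wno|/(_ 0 erefl)].
  split=> [/eqP|c x y -> ->]; first by rewrite (negbTE e0).
  by rewrite /= scaler0 addr0.
have WZ c x : W x -> W (c *: x) by move=> Wx; rewrite -[_ *: _]addr0; exact: Wlin.
have dec a : exists c, W (a - c *: e).
  have [Wa|nWa] := pselect (W a); first by exists 0; rewrite scale0r subr0.
  pose W' : set A := [set x | exists c, W (x - c *: a)].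
  have W'lin c x y : W' x -> W' y -> W' (c *: x + y).
    move=> [d Wd] [d' Wd']; exists (c * d + d').
    rewrite scalerDl -scalerA opprD addrACA -scalerBr; exact: Wlin.
  have [d Wd] : W' e.
    apply: contrapT => nW'e; apply: (Wmax W') => //; split.
      by move=> x Wx; exists 0; rewrite scale0r subr0.
    by move=> /(_ a) Wa; apply/nWa/Wa; exists 1; rewrite scale1r subrr.
  have d0 : d != 0 by apply: contra_notN We => /eqP d0; move: Wd; rewrite d0 scale0r subr0.
  exists d^-1; rewrite -[a in a - _](scalerK d0) -scalerBr.
  by apply: (WZ); have := WZ (- 1) _ Wd; rewrite scaleN1r opprB.
have uniq_dec c c' a : W (a - c *: e) -> W (a - c' *: e) -> c = c'.
  move=> Wc Wc'; apply/eqP; rewrite -subr_eq0; apply: contra_notT We => cc'.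
  rewrite -[e](scalerK cc'); apply: WZ.
  have -> : (c - c') *: e = -1 *: (a - c *: e) + (a - c' *: e).
    by rewrite scaleN1r opprB scalerBl addrA subrK.
  exact: Wlin.
have [f fP] := choice dec; exists f.
  move=> c x y; apply: (@uniq_dec _ _ (c *: x + y)) (fP _) _.
  by rewrite scalerDl -scalerA opprD addrACA -scalerBr; exact: Wlin.
by apply: (@uniq_dec _ _ e) (fP _) _; rewrite scale1r subrr.
Qed.

Variables (A B : algType k).
Local Notation T := (tensor A B).

Definition tmul (x y : T) : T :=
  tlift (fun a b => tlift (fun a' b' => (a * a') *t (b * b')) y) x.
Definition tone : T := 1 *t 1.

Lemma tmul_bilin_in a b :
  bilinear_map (fun a' b' => (a * a') *t (b * b') : T).
Proof.
have [tl tr] := @tens_bilinear k A B.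
by split=> z c x y; rewrite mulrDr -scalerAr; [exact: tl|exact: tr].
Qed.

Lemma tmul_bilin_out y :
  bilinear_map (fun a b => tlift (fun a' b' => (a * a') *t (b * b') : T) y).
Proof.
have [tl tr] := @tens_bilinear k A B.
split=> z c u v; rewrite /= /tlift /tsum scaler_sumr -big_split /=;
  apply: eq_bigr => p _; rewrite mulrDl -scalerAl; [exact: tl|exact: tr].
Qed.

Lemma tmul_linearl y : linear (tmul^~ y).
Proof. exact: tlift_linear (tmul_bilin_out y). Qed.

Lemma tmul_linearr x : linear (tmul x).
Proof.
move=> c y z; rewrite /tmul /tlift /tsum scaler_sumr -big_split /=.
apply: eq_bigr => p _; exact: (tlift_linear (tmul_bilin_in p.1 p.2)).
Qed.

Lemma tmul_tens a b a' b' : tmul (a *t b) (a' *t b') = (a * a') *t (b * b').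
Proof.
rewrite /tmul tlift_tens; last exact: tmul_bilin_out.
by rewrite tlift_tens //; exact: tmul_bilin_in.
Qed.

Lemma comp_linear (X Y Z : lmodType k) (f : Y -> Z) (g : X -> Y) :
  linear f -> linear g -> linear (f \o g).
Proof. by move=> lf lg c x y; rewrite /= lg lf. Qed.

Lemma tmulA : associative tmul.
Proof.
move=> x y z.
move: x; apply: tensor_ext => [||a b].
- exact: tmul_linearl.
- exact: (comp_linear (tmul_linearl z) (tmul_linearl y)).
move: y; apply: tensor_ext => [||a' b'].
- exact: (comp_linear (tmul_linearr _) (tmul_linearl z)).
- exact: (comp_linear (tmul_linearl z) (tmul_linearr _)).
move: z; apply: tensor_ext => [||a'' b''].
- exact: (comp_linear (tmul_linearr _) (tmul_linearr _)).
- exact: tmul_linearr.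
by rewrite !tmul_tens !mulrA.
Qed.

Lemma tmul1l : left_id tone tmul.
Proof.
apply: tensor_ext => [||a b]; first exact: tmul_linearr.
- by [].
- by rewrite tmul_tens !mul1r.
Qed.

Lemma tmul1r : right_id tone tmul.
Proof.
apply: tensor_ext => [||a b]; first exact: tmul_linearl.
- by [].
- by rewrite tmul_tens !mulr1.
Qed.

Lemma tmulDl : left_distributive tmul +%R.
Proof.
by move=> x y z; have := tmul_linearl z 1 x y; rewrite !scale1r.
Qed.

Lemma tmulDr : right_distributive tmul +%R.
Proof.
by move=> x y z; have := tmul_linearr x 1 y z; rewrite !scale1r.
Qed.

Lemma tone_neq0 : tone != 0.
Proof.
have [f lf f1] := exists_functional (oner_neq0 A).
have [g lg g1] := exists_functional (oner_neq0 B).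
have bfg : bilinear_map (fun a b => f a * g b : k^o).
  split=> z c x y; first by rewrite lf mulrDl -scalerAl.
  by rewrite lg mulrDr -scalerAr.
apply/eqP => /(congr1 (tlift (fun a b => f a * g b : k^o))).
rewrite tlift_tens // tlift_zero // f1 g1 mulr1 => /eqP.
by rewrite oner_eq0.
Qed.

HB.instance Definition _ :=
  GRing.Zmodule_isNzRing.Build T tmulA tmul1l tmul1r tmulDl tmulDr tone_neq0.

Lemma tscaleAl c (x y : T) : c *: (x * y) = (c *: x) * y.
Proof. exact: esym (scalable_linear (tmul_linearl y) c x). Qed.

HB.instance Definition _ := GRing.Lmodule_isLalgebra.Build k T tscaleAl.

Lemma tscaleAr c (x y : T) : c *: (x * y) = x * (c *: y).
Proof. exact: esym (scalable_linear (tmul_linearr x) c y). Qed.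

HB.instance Definition _ := GRing.Lalgebra_isAlgebra.Build k T tscaleAr.

Lemma tensM a b a' b' : (a *t b : T) * (a' *t b') = (a * a') *t (b * b').
Proof. exact: tmul_tens. Qed.

End TensorAlgebra.

Section YangBaxterPairs.
Variables (k : fieldType) (A : algType k).

Definition scrF (r : tensor A A) (a : A) : A := tlift (fun x y => x * a * y) r.

Lemma scrF_bilinear a : bilinear_map (fun x y : A => x * a * y).
Proof.
split=> z c x y; first by rewrite !mulrDl -!scalerAl.
by rewrite mulrDr -scalerAr.
Qed.

Lemma scrF_tens (x y a : A) : scrF (x *t y) a = x * a * y.
Proof. exact: tlift_tens (scrF_bilinear a). Qed.

Lemma scrF_is_linear (r : tensor A A) : linear (scrF r).
Proof.
move=> c a b; rewrite /scrF /tlift /tsum scaler_sumr -big_split /=.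
by apply: eq_bigr => p _; rewrite mulrDr mulrDl -scalerAr -scalerAl.
Qed.

HB.instance Definition _ (r : tensor A A) :=
  GRing.isLinear.Build k A A *:%R (scrF r) (@scrF_is_linear r).

Definition coupled_rota_baxter (R S : {linear A -> A}) : Prop :=
  forall a b : A,
    R a * R b = R (R a * b + a * S b) /\ S a * S b = S (R a * b + a * S b).

(* A (x) A (x) A, bracketed to the left; accordingly 1 (x) r below is the sum
   of the (1 (x) r1) (x) r2. *)
Local Notation T3 := (tensor (tensor A A) A).

Definition leg12 (r : tensor A A) : T3 := r *t 1.
Definition leg13 (r : tensor A A) : T3 := tlift (fun x y => (x *t 1) *t y) r.
Definition leg23 (r : tensor A A) : T3 := tlift (fun x y => (1 *t x) *t y) r.

Lemma leg12_tens (x y : A) : leg12 (x *t y) = (x *t y) *t 1.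
Proof. by []. Qed.

Lemma leg13_tens (x y : A) : leg13 (x *t y) = (x *t 1) *t y.
Proof.
have [tl tr] := @tens_bilinear k (tensor A A) A.
have [tl' _] := @tens_bilinear k A A.
by apply: tlift_tens; split=> z c u v; rewrite ?tl' ?tl ?tr.
Qed.

Lemma leg23_tens (x y : A) : leg23 (x *t y) = (1 *t x) *t y.
Proof.
have [tl tr] := @tens_bilinear k (tensor A A) A.
have [_ tr'] := @tens_bilinear k A A.
by apply: tlift_tens; split=> z c u v; rewrite ?tr' ?tl ?tr.
Qed.

Definition yang_baxter_pair (r s : tensor A A) : Prop :=
  leg13 r * leg12 r - leg12 r * leg23 r + leg23 s * leg13 r = 0 /\
  leg13 s * leg12 r - leg12 s * leg23 s + leg23 s * leg13 s = 0.

End YangBaxterPairs.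

(* Main.v *)
(* On pure tensors, [((x *t y) *t z)] acts on a pair [(a, b)] by [x a y b z].
   Under this action the two Yang-Baxter equations become the two coupled
   Rota-Baxter identities, over any algebra.  For matrices both this action and
   [scrF] are invertible: with [E] the matrix units,
     [\sum_(j, k, l) (x E_jk y E_lj) *t E_kl = x *t y],
   because [\sum_j E_jk y E_lj = y_kl 1]. *)
Require Import Defs.
From HB Require Import structures.
From mathcomp Require Import all_boot all_order all_algebra.
From mathcomp Require Import boolp classical_sets functions.

Set Implicit Arguments.
Unset Strict Implicit.
Unset Printing Implicit Defensive.

Import GRing.Theory.
Local Open Scope ring_scope.

(** * Generalities on linear maps *)

(** The set of operators in the theorem consists of bundled maps, so pointwise equality must be
    lifted to the bundles; their proof components agree by proof irrelevance. *)
Lemma linear_ext (k : fieldType) (U V : lmodType k) (f g : {linear U -> V}) :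
  f =1 g -> f = g.
Proof.
move: f g => [f [[f1] [f2]]] [g [[g1] [g2]]] /= /funext fg.
case: g / fg g1 g2 => g1 g2.
by rewrite (Prop_irrelevance f1 g1) (Prop_irrelevance f2 g2).
Qed.

Lemma linear_big (k : fieldType) (U V : lmodType k) (f : U -> V) (I : Type)
    (r : seq I) (P : pred I) (F : I -> U) : linear f ->
  f (\sum_(i <- r | P i) F i) = \sum_(i <- r | P i) f (F i).
Proof.
move=> lf; elim/big_rec2: _ => [|i y x _ <-].
  by have := scalable_linear lf 0 0; rewrite /= !scale0r.
by have := lf 1 (F i) x; rewrite !scale1r.
Qed.

(** * Two-variable action of triple tensors, over any algebra *)

Section Actions.
Variables (k : fieldType) (A : algType k).
Implicit Types (r s : tensor A A) (a b : A).

Definition scrF2 (t : tensor (tensor A A) A) (a b : A) : A :=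
  tlift (fun u z => scrF u a * b * z) t.

Lemma scrF_linear_tensor a : linear (fun r => scrF r a).
Proof. exact: tlift_linear (scrF_bilinear a). Qed.

Lemma scrF2_bilinear a b :
  bilinear_for *:%R *:%R (fun (u : tensor A A) z => scrF u a * b * z).
Proof.
split=> z c u v; first by rewrite scrF_linear_tensor !mulrDl -!scalerAl.
by rewrite mulrDr -scalerAr.
Qed.

Lemma scrF2_linear a b : linear (fun t => scrF2 t a b).
Proof. exact: tlift_linear (scrF2_bilinear a b). Qed.

Lemma scrF2_tens x y z a b :
  scrF2 ((x *t y) *t z) a b = x * a * y * b * z.
Proof. by rewrite /scrF2 tlift_tens ?scrF_tens //; exact: scrF2_bilinear. Qed.

Lemma leg12_linear : linear (@leg12 k A).
Proof. by move=> c u v; rewrite /leg12 (tens_bilinear _ _).1. Qed.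

Lemma leg13_linear : linear (@leg13 k A).
Proof.
apply: tlift_linear; split=> z c u v; last exact: (tens_bilinear _ _).2.
by rewrite (tens_bilinear _ _).1 (tens_bilinear _ _).1.
Qed.

Lemma leg23_linear : linear (@leg23 k A).
Proof.
apply: tlift_linear; split=> z c u v; last exact: (tens_bilinear _ _).2.
by rewrite (tens_bilinear _ _).2 (tens_bilinear _ _).1.
Qed.

Let legP := (leg12_linear, leg13_linear, leg23_linear).
Let legE := (@leg12_tens k A, @leg13_tens k A, @leg23_tens k A).

(** For [r = x *t y] and [s = x' *t y'] the product is [(x * x') *t y' *t y], and [x x' a y' b y] is
    [s] applied inside [r]. *)
Lemma scrF2_leg13_leg12 r s a b :
  scrF2 (leg13 r * leg12 s) a b = scrF r (scrF s a * b).
Proof.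
move: r; apply: tensor_ext => [c u v|c u v|x y].
- by rewrite legP mulrDl -scalerAl scrF2_linear.
- by rewrite scrF_linear_tensor.
move: s; apply: tensor_ext => [c u v|c u v|x' y'].
- by rewrite legP mulrDr -scalerAr scrF2_linear.
- by rewrite scrF_linear_tensor mulrDl -scalerAl linearP.
by rewrite !legE !tensM mul1r mulr1 scrF2_tens !scrF_tens !mulrA.
Qed.

(** Here the product is [x *t (y * x') *t y']: the middle factor [y x'] joins [x a y] to
    [x' b y']. *)
Lemma scrF2_leg12_leg23 r s a b :
  scrF2 (leg12 r * leg23 s) a b = scrF r a * scrF s b.
Proof.
move: r; apply: tensor_ext => [c u v|c u v|x y].
- by rewrite legP mulrDl -scalerAl scrF2_linear.
- by rewrite scrF_linear_tensor mulrDl -scalerAl.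
move: s; apply: tensor_ext => [c u v|c u v|x' y'].
- by rewrite legP mulrDr -scalerAr scrF2_linear.
- by rewrite scrF_linear_tensor mulrDr -scalerAr.
by rewrite !legE !tensM mul1r mulr1 scrF2_tens !scrF_tens !mulrA.
Qed.

(** Here the product is [x *t x' *t (y' * y)], so [x' b y'] sits to the right of [a], inside
    [x _ y]. *)
Lemma scrF2_leg23_leg13 r s a b :
  scrF2 (leg23 s * leg13 r) a b = scrF r (a * scrF s b).
Proof.
move: r; apply: tensor_ext => [c u v|c u v|x y].
- by rewrite legP mulrDr -scalerAr scrF2_linear.
- by rewrite scrF_linear_tensor.
move: s; apply: tensor_ext => [c u v|c u v|x' y'].
- by rewrite legP mulrDl -scalerAl scrF2_linear.
- by rewrite scrF_linear_tensor mulrDr -scalerAr linearP.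
by rewrite !legE !tensM mul1r mulr1 scrF2_tens !scrF_tens !mulrA.
Qed.

Lemma scrF2_0 a b : scrF2 0 a b = 0.
Proof. exact: tlift_zero (scrF2_bilinear a b). Qed.

(** Four free tensors let one computation serve both equations: [(r, r, r, s)] gives the first and
    [(s, r, s, s)] the second. *)
Lemma scrF2_yang_baxter r s r' s' a b :
  scrF2 (leg13 r * leg12 s - leg12 r * leg23 r' + leg23 s' * leg13 r) a b =
  scrF r (scrF s a * b + a * scrF s' b) - scrF r a * scrF r' b.
Proof.
(* Bring the sum to nested [c *: u + v] form, to which [scrF2_linear] applies. *)
rewrite -[_ + leg23 _ * _]addrC -[leg13 r * _ - _]addrC -scaleN1r.
rewrite -[leg23 s' * _]scale1r !scrF2_linear.
rewrite scrF2_leg13_leg12 scrF2_leg12_leg23 scrF2_leg23_leg13 linearD.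
by rewrite scale1r scaleN1r addrCA [_ + scrF r _]addrC addrC.
Qed.

End Actions.

(** * Matrix units and the inversion formulas *)

Lemma mul_delta_mx_delta (R : comPzRingType) (m n p q : nat) (M : 'M[R]_(m, n))
    (i : 'I_p) (j : 'I_m) (l : 'I_n) (o : 'I_q) :
  delta_mx i j *m M *m delta_mx l o = M j l *: delta_mx i o.
Proof.
(* Factor each unit as a column times a row, so that the middle of the product is the 1 by 1 matrix
   with entry [M j l]. *)
rewrite -(mul_delta_mx (0 : 'I_1) i j) -(mul_delta_mx (0 : 'I_1) l o).
rewrite -[_ *m M]mulmxA mulmxA -[X in X *m _]mulmxA -rowE -colE.
rewrite [col _ _]mx11_scalar !mxE mul_mx_scalar -scalemxAl.
by rewrite mul_delta_mx.
Qed.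

Section Matrices.
Variables (k : fieldType) (n : nat).
Local Notation A := ('M[k]_n.+1 : algType k).
Local Notation I := ('I_n.+1 * 'I_n.+1 * 'I_n.+1)%type.
Implicit Types (r s : tensor A A) (q : I).

(* The three matrix units in the header's formula, for q = (j, k, l). *)
Let mxa q : A := delta_mx q.1.1 q.1.2.
Let mxb q : A := delta_mx q.2 q.1.1.
Let mxc q : A := delta_mx q.1.2 q.2.

(** The header's formula is the case where [h] is left multiplication by [x]; a general [h] is
    needed to invert [scrF2]. *)
Lemma tens_casimir (W : lmodType k) (h : A -> W) (y : A) : linear h ->
  \sum_q h (mxa q * y * mxb q) *t mxc q = h 1 *t y.
Proof.
move=> lh; have [tl tr] := @tens_bilinear k W A.
rewrite [in RHS](matrix_sum_delta y) (linear_big _ _ _ (tr _)).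
under [RHS]eq_bigr do rewrite (linear_big _ _ _ (tr _)).
rewrite -(pair_bigA _ (fun p l => h (mxa (p, l) * y * mxb (p, l)) *t mxc (p, l))).
rewrite -(pair_bigA _ (fun i j => \sum_l h (mxa (i, j, l) * y * mxb (i, j, l))
  *t mxc (i, j, l))) /= exchange_big /=; apply: eq_bigr => j _.
rewrite exchange_big /=; apply: eq_bigr => l _.
(* With [j] and [l] fixed, the sum over [i] on the left matches the expansion of [1] term by term,
   with the common coefficient [y j l]. *)
have -> : 1 = \sum_i delta_mx i i :> A by exact: mx1_sum_delta.
rewrite (bilin_Zr _ _ _ (tens_bilinear _ _)) (linear_big _ _ _ lh).
rewrite (linear_big _ _ _ (tl _)) scaler_sumr; apply: eq_bigr => i _.
rewrite [_ * _ * _]mul_delta_mx_delta [h _](scalable_linear lh).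
exact: bilin_Zl (tens_bilinear _ _).
Qed.

Lemma scrF_inv r : \sum_q (scrF r (mxa q) * mxb q) *t mxc q = r.
Proof.
have [tl _] := @tens_bilinear k A A.
move: r; apply: tensor_ext => [c u v|//|x y].
  rewrite scaler_sumr -big_split; apply: eq_bigr => q _.
  by rewrite scrF_linear_tensor mulrDl -scalerAl tl.
rewrite -[x in RHS]mulr1 -(tens_casimir (h := *%R x)); last first.
  by move=> c u v; rewrite mulrDr -scalerAr.
by apply: eq_bigr => q _; rewrite scrF_tens !mulrA.
Qed.

(** The witness is the formula of [scrF_inv] with [f] for [scrF r]. At [a], the term [(i, j, l)] is
    [f E_ij E_li a E_jl = a_ij f(E_ij) E_ll]; summing over [l] and then over [i], [j] gives
    [f a]. *)
Lemma scrF_surj (f : {linear A -> A}) : exists r, scrF r =1 f.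
Proof.
exists (\sum_q (f (mxa q) * mxb q) *t mxc q) => a.
rewrite (linear_big _ _ _ (scrF_linear_tensor a)).
rewrite [a in RHS]matrix_sum_delta linear_sum.
rewrite -(pair_bigA _ (fun p l =>
  scrF ((f (mxa (p, l)) * mxb (p, l)) *t mxc (p, l)) a)) /=.
rewrite -(pair_bigA _ (fun i j => \sum_l
  scrF ((f (mxa (i, j, l)) * mxb (i, j, l)) *t mxc (i, j, l)) a)) /=.
apply: eq_bigr => i _; rewrite linear_sum; apply: eq_bigr => j _.
rewrite linearZ /= -[f _ in RHS]mulr1.
have -> : 1 = \sum_l delta_mx l l :> A by exact: mx1_sum_delta.
rewrite mulr_sumr scaler_sumr; apply: eq_bigr => l _.
rewrite scrF_tens -!mulrA [_ * (a * _)]mulrA [_ * a * _]mul_delta_mx_delta.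
by rewrite scalerAr.
Qed.

Lemma scrF2_inv (t : tensor (tensor A A) A) :
  \sum_p (\sum_q (scrF2 t (mxa q) (mxa p) * mxb p * mxb q) *t mxc q) *t mxc p
  = t.
Proof.
have [tl _] := @tens_bilinear k A A.
have [tl2 _] := @tens_bilinear k (tensor A A) A.
move: t; apply: tensor_ext => [c u v|//|u z].
  rewrite scaler_sumr -big_split /=; apply: eq_bigr => p _.
  rewrite -tl2 scaler_sumr -big_split /=; congr (_ *t _); apply: eq_bigr => q _.
  by rewrite scrF2_linear !mulrDl -!scalerAl tl.
(* The inner sum for index [p] is [h (mxa p * z * mxb p)], so [tens_casimir] collapses the outer sum
   to [h 1 *t z], and [scrF_inv] identifies [h 1] with [u]. *)
pose h (m : A) : tensor A A := \sum_q (scrF u (mxa q) * m * mxb q) *t mxc q.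
have lh : linear h.
  move=> c a b; rewrite /h scaler_sumr -big_split; apply: eq_bigr => q _.
  by rewrite mulrDr mulrDl -scalerAr -scalerAl tl.
have h1 : h 1 = u.
  by rewrite -[RHS]scrF_inv; apply: eq_bigr => q _; rewrite mulr1.
rewrite -[u in RHS]h1 -(tens_casimir z lh); apply: eq_bigr => p _; congr (_ *t _).
apply: eq_bigr => q _; congr (_ *t _).
by rewrite /scrF2 tlift_tens ?mulrA //; exact: scrF2_bilinear.
Qed.

(** By [scrF2_inv] the action determines the tensor; this is what turns operator identities back
    into Yang-Baxter equations. *)
Lemma scrF2_eq0 (t : tensor (tensor A A) A) :
  (forall a b, scrF2 t a b = 0) -> t = 0.
Proof.
move=> t0; rewrite -[t]scrF2_inv -[RHS]scrF2_inv.
apply: eq_bigr => p _; congr (_ *t _); apply: eq_bigr => q _.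
by rewrite t0 scrF2_0.
Qed.

Lemma yang_baxter_pairP r s :
  yang_baxter_pair r s <-> coupled_rota_baxter (scrF r) (scrF s).
Proof.
split=> [[rs1 rs2] a b | rs].
  by split; apply/esym/eqP; rewrite -subr_eq0 -scrF2_yang_baxter ?rs1 ?rs2 scrF2_0.
by split; apply: scrF2_eq0 => a b; have [rs1 rs2] := rs a b;
  rewrite scrF2_yang_baxter ?rs1 ?rs2 subrr.
Qed.

End Matrices.

Theorem theorem1p5 (k : fieldType) (hk : [pchar k] =i pred0) (n : nat) :
  let A : algType k := 'M[k]_n.+1 in
  set_bij
    [set p : tensor A A * tensor A A | yang_baxter_pair p.1 p.2]
    [set q : {linear A -> A} * {linear A -> A} | coupled_rota_baxter q.1 q.2]
    (fun p => (scrF p.1 : {linear A -> A}, scrF p.2 : {linear A -> A})).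
Proof.
have scrF_inj : injective (@scrF k ('M[k]_n.+1 : algType k)).
  by move=> r s rs; rewrite -[r]scrF_inv rs scrF_inv.
split=> [[r s] /yang_baxter_pairP // | [r s] [r' s'] _ _ | [R S] RS].
  move=> eq_rs; congr (_, _); apply: scrF_inj.
    exact: (congr1 (fun q => GRing.Linear.sort q.1) eq_rs).
  exact: (congr1 (fun q => GRing.Linear.sort q.2) eq_rs).
have [r /linear_ext rE] := scrF_surj R.
have [s /linear_ext sE] := scrF_surj S.
exists (r, s); last by rewrite /= rE sE.
by apply/yang_baxter_pairP; rewrite rE sE.
Qed.
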